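(* Let $p\in(0,1)$, let $\mathcal{M}=(M_n)_{n\in\mathbb{Z}_+}$ be a deterministic non-decreasing sequence with $M_0\geq2$, and let $\bar{\mathcal{G}}$ be the oriented graph with ranges $\mathcal{M}$. Let the letters $(X_n)_{n\in\mathbb{Z}_+}$ be i.i.d. Bernoulli($p$), with law $P_{\bar{\mathcal{G}}}$. Let $\xi^*=(0,0,0,\dots)$ if $p\geq1/2$ and $\xi^*=(1,1,1,\dots)$ if $p<1/2$. Then $$P_{\bar{\mathcal{G}}}(\xi^*\in W_0)>0\iff P_{\bar{\mathcal{G}}}(W_0=\Xi)>0.$$
   Context: $\mathbb{Z}_+=\{0,1,2,\dots\}$, $\mathbb{N}=\{1,2,3,\dots\}$. A word is a sequence $\xi=(\xi_1,\xi_2,\dots)\in\Xi:=\{0,1\}^{\mathbb{N}}$. Given a sequence of (finite, non-negative) ranges $\mathcal{M}=(M_n)_{n\in\mathbb{Z}_+}$, the graph $\bar{\mathcal{G}}=(\mathbb{Z}_+,\mathcal{E})$ is the oriented graph with edge set $\mathcal{E}=\bigcup_{n\in\mathbb{Z}_+}\{(n,n+i): i\in\mathbb{N},\ 0<i\leq M_n\}$. The letter $X_n\in\{0,1\}$ is assigned to vertex $n$, with $X_n=1$ with probability $p$. A word $\xi$ is seen from a vertex $v_0$ if there is a sequence of distinct vertices $v_1,v_2,\dots$ such that $(v_{i-1},v_i)\in\mathcal{E}$ and $X_{v_i}=\xi_i$ for every $i\geq1$ (the letter at $v_0$ plays no role). For a vertex $v$, $W_v=\{\xi\in\Xi:\xi\text{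 is seen from }v\}$. *)

(* Defs.v *)
From HB Require Import structures.
From mathcomp Require Import all_boot all_order all_algebra finmap.
From mathcomp Require Import all_classical all_reals all_analysis.

Set Implicit Arguments.
Unset Strict Implicit.
Unset Printing Implicit Defensive.

Import Order.TTheory GRing.Theory Num.Theory.
Import numFieldNormedType.Exports.

Local Open Scope classical_set_scope.

(* [xi i] is the letter xi_(i+1): words are indexed from 1 in the mathematics
   and from 0 here. *)
Definition word := nat -> bool.

Definition edges (M : nat -> nat) : set (nat * nat) :=
  \bigcup_n [set (n, n + i)%N | i in [set i | (0 < i <= M n)%N]].

(* [v i] is the vertex v_i, so that [v 0] is the starting point; only
   v_1, v_2, ... are required to be distinct and to carry letters. *)
Definition seen (E : set (nat * nat)) (x : nat -> bool) (v0 : nat) (xi : word)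
    : Prop :=
  exists v : nat -> nat,
    [/\ v 0%N = v0,
        {in [pred i | (0 < i)%N] &, injective v},
        forall i, E (v i, v i.+1)
      & forall i, x (v i.+1) = xi i].

Definition W (E : set (nat * nat)) (x : nat -> bool) (v : nat) : set word :=
  [set xi | seen E x v xi].

Local Open Scope ereal_scope.

Definition mutually_independent d (T : measurableType d) (R : realType)
    (P : probability T R) d' (T' : measurableType d') (I : choiceType)
    (X : I -> {RV P >-> T'}) : Prop :=
  forall (J : {fset I}) (B : I -> set T'), (forall i, measurable (B i)) ->
    P (\bigcap_(i in [set` J]) (X i @^-1` B i)) =
    \prod_(i <- J) P (X i @^-1` B i).

Definition iid_bernoulli d (T : measurableType d) (R : realType)
    (P : probability T R) (p : R) (X : nat -> {RV P >-> bool}) : Prop :=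
  mutually_independent X /\
  forall (n : nat) (B : set bool), measurable B ->
    distribution P (X n) B = bernoulli_prob p B.

Local Close Scope ereal_scope.
Local Open Scope ring_scope.

Definition xi_star (R : realType) (p : R) : word :=
  if 2^-1 <= p then fun=> false else fun=> true.

(* Main.v *)
Require Import Defs.
From HB Require Import structures.
From mathcomp Require Import all_boot all_order all_algebra finmap.
From mathcomp Require Import all_classical all_reals all_analysis.
From mathcomp Require Import zify lra ring.

(** Let c be the letter of the constant word, so that c is at most as likely as
the other letter; write r <= t for the two letter probabilities.  Both sides of
the equivalence amount to the convergence of the series of the t ^+ M n.

If the word c c c ... is seen from 0, then every window n + 1, ..., n + M n
contains the letter c: a path that jumped over such a window would use an edge
from some u <= n with M u > M n, contrary to monotonicity.  Hence no n carries
a rare gap, that is, an occurrence of c followed by M n copies of the other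
letter.  A rare gap at n has probability r * t ^+ M n, excludes rare gaps at
the next M n vertices, and is independent of what happens beyond them.
Multiplying the probability that no gap occurs by one plus the sum of the gap
probabilities therefore never gives more than 1 ([Pr_no_rare_gap]), so that a
positive probability of seeing c c c ... bounds the partial sums
([seen_rare_summable]).

Conversely, if every window n + 1, ..., n + M n contains both letters, every
word can be read greedily ([all_words_seen]).  When the series converges, the
union bound makes the windows from some N on good with a probability that stays
positive even if the letter at N + 1 is prescribed to be c ([Pr_good_tail]);
the bound works for both missing letters because r <= t. This event is
independent of the letters at 1, ..., N, and prescribing these to alternate
makes the first N windows good too, since they have length at least 2
([alternating_both], [all_words_seen_positive]).

Two technical points.  Seeing an infinite word is the same as seeing all its
finite prefixes, by König's lemma ([seen_prefixes]); this makes the two events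
countable intersections of events about finitely many letters, hence
measurable.  All the probability computations concern such finite events, and
the only independence they use is that of a prescribed block of letters from an
event about later letters ([Pr_cylinder_indep]). *)

Import Order.TTheory GRing.Theory Num.Theory.
Import numFieldNormedType.Exports.

Local Open Scope classical_set_scope.
Local Open Scope ring_scope.

(** * Paths and finite prefixes of words *)

Definition window (x : nat -> bool) (a k : nat) : seq bool :=
  [seq x i | i <- iota a k].

Section Paths.
Variable M : nat -> nat.
Implicit Types (x : nat -> bool) (s : seq bool) (xi : word).

Fixpoint sees x v s : bool :=
  if s is e :: s' then
    has (fun u => (x u == e) && sees x u s') (iota v.+1 (M v))
  else true.

Lemma edgesP u v : edges M (u, v) <-> v \in iota u.+1 (M u).
Proof.
rewrite mem_iota; split.
  by case=> n _ [i /= hi [<- <-]]; lia.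
move=> h; exists u => //; exists (v - u)%N => /=; first by lia.
by congr pair; lia.
Qed.

Lemma sees_take x v s n : sees x v s -> sees x v (take n s).
Proof.
elim: s v n => [|e s IH] v [|n] //= /hasP[u hu /andP[xu /IH su]].
by apply/hasP; exists u; rewrite ?xu /=.
Qed.

Lemma window_sees_le x v xi i m n :
  (m <= n)%N -> sees x v (window xi i n) -> sees x v (window xi i m).
Proof.
move=> mn /sees_take -/(_ m).
by rewrite /window -map_take take_iota (minn_idPl mn).
Qed.

(** The pigeonhole step of König's lemma: [v] has finitely many out-neighbours
and longer prefixes are harder to see, so if each neighbour failed on some
prefix, all would fail on the longest of these. *)
Lemma sees_step x v xi i : (forall n, sees x v (window xi i n)) ->
  exists u, [/\ u \in iota v.+1 (M v), x u = xi i
              & forall n, sees x u (window xi i.+1 n)].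
Proof.
move=> hv; apply: contrapT => nex.
have bad u : exists n, u \in iota v.+1 (M v) -> x u = xi i ->
    ~~ sees x u (window xi i.+1 n).
  apply: contrapT => nn; apply: nex; exists u; split.
  - by apply: contrapT => h; apply: nn; exists 0%N => /h.
  - by apply: contrapT => h; apply: nn; exists 0%N => _ /h.
  - by move=> n; apply/negPn/negP => h; apply: nn; exists n.
have [f fP] := choice bad.
have /hasP[u hu /andP[/eqP xu su]] := hv (\max_(u <- iota v.+1 (M v)) f u).+1.
have /negP := fP u hu xu; apply; apply: window_sees_le su.
exact: leq_bigmax_seq.
Qed.

Lemma seen_prefixes x v xi :
  seen (edges M) x v xi <-> forall n, sees x v (window xi 0 n).
Proof.
split=> [[f [f0 _ fE fx]] n|hv].
  rewrite -f0; elim: n 0%N => [//|n IH] i.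
  apply/hasP; exists (f i.+1); first exact/edgesP.
  by rewrite fx eqxx; exact: IH.
(* A state is a pair (number of letters read, current vertex). *)
have nxtP (q : nat * nat) : exists u,
    (forall n, sees x q.2 (window xi q.1 n)) ->
    [/\ u \in iota q.2.+1 (M q.2), x u = xi q.1
      & forall n, sees x u (window xi q.1.+1 n)].
  case: (pselect (forall n, sees x q.2 (window xi q.1 n))) => [/sees_step|nh].
    by move=> [u hu]; exists u.
  by exists 0%N.
have [nxt nxtE] := choice nxtP.
pose f := fix f i := if i is j.+1 then nxt (j, f j) else v.
have fP i : forall n, sees x (f i) (window xi i n).
  by elim: i => [//|i /(nxtE (i, f i))[]].
have fS i : edges M (f i, f i.+1).
  by apply/edgesP; have [] := nxtE (i, f i) (fP i).
have fmono : {homo f : i j / (i < j)%N}.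
  apply: homo_ltn => [? ? ?|i]; first exact: ltn_trans.
  by have /edgesP := fS i; rewrite mem_iota => /andP[].
exists f; split=> // [i j _ _ fij|i].
  by case: (ltngtP i j) => // /fmono; rewrite fij ltnn.
by have [] := nxtE (i, f i) (fP i).
Qed.

Lemma in_window x c a k :
  reflect (exists2 u, (a <= u < a + k)%N & x u = c) (c \in window x a k).
Proof.
apply: (iffP mapP) => [[u hu ->]|[u hu <-]]; exists u => //.
  by rewrite mem_iota in hu.
by rewrite mem_iota.
Qed.

(** A path seeing the constant word has a last vertex at or before [n]; its
next vertex is beyond [n], within reach because the range of an earlier vertex
is at most [M n], and carries the letter [c]. *)
Lemma seen_constant_window x c n : {homo M : m n / (m <= n)%N} ->
  seen (edges M) x 0 (fun=> c) -> c \in window x n.+1 (M n).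
Proof.
move=> Mmono [f [f0 _ fE fx]].
have fS i : (f i < f i.+1 <= f i + M (f i))%N.
  by have /edgesP := fE i; rewrite mem_iota; lia.
have fge i : (i <= f i)%N by elim: i => // i IH; have := fS i; lia.
have [||i fi fi1] := @ex_maxnP (fun i => f i <= n)%N n.
- by exists 0%N; rewrite f0.
- by move=> i; have := fge i; lia.
apply/in_window; exists (f i.+1); last exact: fx.
have := Mmono _ _ fi; have := fS i.
by case: (leqP (f i.+1) n) => [/fi1|]; lia.
Qed.

Lemma all_words_seen x v :
  (forall n e, e \in window x n.+1 (M n)) -> W (edges M) x v = setT.
Proof.
move=> hx; apply/seteqP; split=> // xi _; apply/seen_prefixes => n.
elim: (window xi 0 n) v => //= e s IH v.
have /mapP[u hu xu] := hx v e.
by apply/hasP; exists u => //; rewrite -xu eqxx IH.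
Qed.

End Paths.

(** * Events that depend on finitely many letters *)

Definition determined (a b : nat) (F : (nat -> bool) -> bool) : Prop :=
  forall x y, (forall i, (a <= i < b)%N -> x i = y i) -> F x = F y.

Definition finitary (F : (nat -> bool) -> bool) : Prop :=
  exists b, determined 0 b F.

(** Used to split an event according to the letter at [b]. *)
Definition set_letter (b : nat) (e : bool) (x : nat -> bool) : nat -> bool :=
  fun i => if i == b then e else x i.

Lemma set_letter_id b x : set_letter b (x b) x = x.
Proof. by apply/funext => i; rewrite /set_letter; case: eqP => [->|]. Qed.

Lemma determined_sub a b a' b' F :
  (a' <= a)%N -> (b <= b')%N -> determined a b F -> determined a' b' F.
Proof. by move=> ha hb dF x y xy; apply: dF => i hi; apply: xy; lia. Qed.

Lemma determined_finitary a b F : determined a b F -> finitary F.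
Proof. by move=> dF; exists b; apply: determined_sub dF. Qed.

Lemma determined_andb a b F G :
  determined a b F -> determined a b G -> determined a b (fun x => F x && G x).
Proof. by move=> dF dG x y xy; rewrite (dF _ _ xy) (dG _ _ xy). Qed.

Lemma determined_negb a b F : determined a b F -> determined a b (negb \o F).
Proof. by move=> dF x y xy /=; rewrite (dF _ _ xy). Qed.

Lemma determined_all (A : eqType) a b (s : seq A) F :
  (forall u, u \in s -> determined a b (F u)) ->
  determined a b (fun x => all (F^~ x) s).
Proof. by move=> dF x y xy; apply: eq_in_all => u us; exact: dF. Qed.

Lemma determined_window a k (F : seq bool -> bool) :
  determined a (a + k) (fun x => F (window x a k)).
Proof.
move=> x y xy; congr F; apply/eq_in_map => i.
by rewrite mem_iota => /xy.
Qed.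

Definition reads (a : nat) (s : seq bool) (x : nat -> bool) : bool :=
  window x a (size s) == s.

Lemma determined_reads a s : determined a (a + size s) (reads a s).
Proof. exact: (determined_window _ _ (pred1 s)). Qed.

Lemma determined_letter b c : determined b b.+1 (fun x => x b == c).
Proof. by move=> x y -> //; rewrite leqnn ltnSn. Qed.

Lemma finitary_andb F G :
  finitary F -> finitary G -> finitary (fun x => F x && G x).
Proof.
move=> [b dF] [b' dG]; exists (maxn b b').
by apply: determined_andb; [apply: determined_sub dF|apply: determined_sub dG];
  rewrite // (leq_maxl, leq_maxr).
Qed.

Lemma finitary_negb F : finitary F -> finitary (negb \o F).
Proof. by move=> [b dF]; exists b; exact: determined_negb. Qed.

Lemma finitary_has A (s : seq A) F : (forall u, finitary (F u)) ->
  finitary (fun x => has (F^~ x) s).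
Proof.
move=> fF; elim: s => [|u s [b ds]]; first by exists 0%N.
have [b' du] := fF u; exists (maxn b b') => x y xy /=.
rewrite (du x y) 1?(ds x y) // => i hi; apply: xy; rewrite leq_max;
  by move: hi => /= ->; rewrite ?orbT.
Qed.

Lemma finitary_letter b c : finitary (fun x => x b == c).
Proof. exact/determined_finitary/determined_letter. Qed.

Lemma finitary_sees M v s : finitary (fun x => sees M x v s).
Proof.
elim: s v => [|e s IH] v /=; first by exists 0%N.
by apply: finitary_has => u; apply: finitary_andb => //; exact: finitary_letter.
Qed.

Lemma determined_set_letterl a b e F : determined a b F ->
  determined a.+1 b (F \o set_letter a e).
Proof.
move=> dF x y xy; apply: dF => i hi; rewrite /set_letter.
by case: eqP => // ia; apply: xy; lia.
Qed.

Lemma determined_set_letterr a b e F : determined a b.+1 F ->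
  determined a b (F \o set_letter b e).
Proof.
move=> dF x y xy; apply: dF => i hi; rewrite /set_letter.
by case: eqP => // ia; apply: xy; lia.
Qed.

Definition letter_prob {R : realType} (p : R) (e : bool) : R :=
  if e then p else 1 - p.

Section Law.
Context {R : realType} (p : R) (hp : 0 < p < 1).
Context {d : measure_display} {T : measurableType d} (P : probability T R).
Context (X : nat -> {RV P >-> bool}) (X_iid : iid_bernoulli p X).
Implicit Types F G : (nat -> bool) -> bool.

Definition letters (w : T) : nat -> bool := fun n => X n w.

Definition Pr F : R := fine (P [set w | F (letters w)]).

Lemma measurable_letter n c : measurable [set w | X n w == c].
Proof.
have -> : [set w | X n w == c] = X n @^-1` [set c].
  by apply/seteqP; split=> w /eqP.
exact: measurable_funPTI.
Qed.

Lemma finitary_measurable F : finitary F -> measurable [set w | F (letters w)].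
Proof.
move=> [b]; elim: b F => [|b IH] F dF.
  under eq_set do rewrite (dF _ (fun=> true)) //.
  case: (F _); [have -> : [set _ : T | true] = setT|
    have -> : [set _ : T | false] = set0];
    by [apply/seteqP; split|exact: measurableT|exact: measurable0].
have -> : [set w | F (letters w)] = \bigcup_(e in setT)
    ([set w | X b w == e] `&` [set w | F (set_letter b e (letters w))]).
  apply/seteqP; split=> w /=.
    move=> Fw; exists (X b w) => //; split=> //=.
    by rewrite -[X b w]/(letters w b) set_letter_id.
  by move=> [e _ [/= /eqP <-]]; rewrite -[X b w]/(letters w b) set_letter_id.
apply: fin_bigcup_measurable; first exact: finite_finset.
move=> e _; apply: measurableI.
  exact: measurable_letter.
exact: (IH _ (determined_set_letterr _ _ e _ dF)).
Qed.

Lemma Pr_fineK F : finitary F -> P [set w | F (letters w)] = (Pr F)%:E.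
Proof. by move=> /finitary_measurable mF; rewrite fineK // fin_num_measure. Qed.

Lemma Pr_ge0 F : 0 <= Pr F.
Proof. exact: fine_ge0. Qed.

Lemma Pr_le F G : finitary F -> finitary G -> (forall x, F x -> G x) ->
  Pr F <= Pr G.
Proof.
move=> fF fG FG; rewrite -lee_fin -!Pr_fineK //.
apply: le_measure; rewrite ?inE; [exact: finitary_measurable..|].
by move=> w /=; exact: FG.
Qed.

Lemma Pr_le1 F : finitary F -> Pr F <= 1.
Proof.
by move=> /[dup] /finitary_measurable mF fF; rewrite -lee_fin -Pr_fineK // probability_le1.
Qed.

Lemma Pr_true : Pr (fun=> true) = 1.
Proof. by rewrite /Pr -[[set _ | _]]/[set` predT] set_true probability_setT. Qed.

Lemma Pr_split F G : finitary F -> finitary G ->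
  Pr F = Pr (fun x => F x && G x) + Pr (fun x => F x && ~~ G x).
Proof.
move=> fF fG; have fFG := finitary_andb _ _ fF fG.
have fFnG := finitary_andb _ _ fF (finitary_negb _ fG).
apply: EFin_inj; rewrite EFinD -!Pr_fineK //.
have mF := finitary_measurable _ fF; have mG := finitary_measurable _ fG.
rewrite [LHS](measureDI _ mF mG) [RHS]addeC.
congr (P _ + P _)%E; apply/seteqP; split=> w /=.
- by move=> [-> /negP].
- by move=> /andP[? /negP].
- by move=> [-> ->].
- by move=> /andP.
Qed.

(** Mutual independence over the block [a], ..., [a + size s - 1]. *)
Lemma Pr_cylinder a (s : seq bool) :
  Pr (reads a s) = \prod_(e <- s) letter_prob p e.
Proof.
have [indep law] := X_iid.
pose B i : set bool := [set nth true s (i - a)].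
have p01 : 0 <= p <= 1 by case/andP: hp => /ltW -> /ltW ->.
have Blaw i : P (X i @^-1` B i) = (letter_prob p (nth true s (i - a)))%:E.
  rewrite -[LHS]/(distribution P (X i) (B i)) law // bernoulli_probE //.
  rewrite !diracE /B !classical_sets.in_set1; case: (nth _ _ _) => /=;
    by rewrite ?mule1 ?mule0 ?adde0 ?add0e.
have [J Jmem Jperm] : exists2 J : {fset nat},
    (forall i, (i \in J) = (a <= i < a + size s)%N)
    & perm_eq J [seq (a + i)%N | i <- iota 0 (size s - 0)].
  exists (seq_fset tt (iota a (size s))) => [i|].
    by rewrite seq_fsetE mem_iota.
  rewrite subn0 -iotaDl addn0; apply: perm_trans (seq_fset_perm _ _) _.
  by rewrite undup_id ?iota_uniq.
have := indep J B (fun=> I); rewrite (perm_big _ Jperm) big_map.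
under eq_bigr do rewrite Blaw addKn.
rewrite prodEFin -(big_nth true xpredT (letter_prob p)) => PJ.
rewrite -[RHS]/(fine _%:E) -PJ.
congr (fine (P _)); apply/seteqP; split=> w /=.
  move=> /eqP ws i; rewrite /= Jmem => hi.
  rewrite /B /= -[in RHS]ws (nth_map 0%N) ?size_iota ?nth_iota; try lia.
  by congr (X _ w); lia.
move=> h; apply/eqP/(@eq_from_nth _ true); rewrite size_map size_iota // => i hi.
rewrite (nth_map 0%N) ?size_iota // nth_iota //.
have := h (a + i)%N; rewrite /= Jmem /B /= addKn; apply.
by lia.
Qed.

(** By induction on the number of letters that [F] may depend on: conditioning
on the first of them, at [a + size s], lengthens the prescribed block by one
letter and leaves an event that depends on one letter less.  The same
expansion for the empty block at [a + size s] reassembles the probability of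
[F]. *)
Lemma Pr_cylinder_indep a (s : seq bool) b F : determined (a + size s) b F ->
  Pr (fun x => reads a s x && F x) =
  (\prod_(e <- s) letter_prob p e) * Pr F.
Proof.
move=> dF.
have [k] : exists k, (b <= a + size s + k)%N by exists b; lia.
elim: k a s F dF => [|k IH] a s F dF bk.
  have FE x : F x = F (fun=> true) by apply: dF; lia.
  rewrite /Pr; under eq_set do rewrite FE; under [in RHS]eq_set do rewrite FE.
  case: (F _).
    under eq_set do rewrite andbT.
    by rewrite -[RHS]/(_ * Pr (fun=> true)) Pr_true mulr1 -(Pr_cylinder a).
  under eq_set do rewrite andbF.
  by rewrite -[[set _ | _]]/[set` pred0] set_false measure0 mulr0.
set c := (a + size s)%N in dF bk *.
have expand a' s' : (a' + size s')%N = c ->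
    Pr (fun x => reads a' s' x && F x) =
    (\prod_(e <- s') letter_prob p e) *
      (letter_prob p true * Pr (F \o set_letter c true) +
       letter_prob p false * Pr (F \o set_letter c false)).
  move=> a's'.
  have fF := determined_finitary _ _ _ dF.
  have fW : finitary (fun x => reads a' s' x && F x).
    by apply: finitary_andb => //; exact/determined_finitary/determined_reads.
  have step e : Pr (fun x => reads a' s' x && F x && (x c == e)) =
      (\prod_(e <- s') letter_prob p e) *
        (letter_prob p e * Pr (F \o set_letter c e)).
    have -> : (\prod_(e <- s') letter_prob p e) *
        (letter_prob p e * Pr (F \o set_letter c e)) =
        (\prod_(e <- rcons s' e) letter_prob p e) * Pr (F \o set_letter c e).
      by rewrite -cats1 big_cat big_seq1 mulrA.
    rewrite -(IH a' (rcons s' e)); last first.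
    - by rewrite size_rcons; lia.
    - by rewrite size_rcons addnS a's'; exact: determined_set_letterl.
    congr (fine (P _)); apply: eq_set => w; congr is_true.
    rewrite /reads size_rcons -addn1 /window iotaD a's' map_cat cats1 eqseq_rcons /=.
    rewrite -andbA [F _ && _]andbC; case: (letters w c =P e) => [<-|].
      by rewrite set_letter_id andbT.
    by rewrite andbF.
  rewrite (Pr_split _ (fun x => x c == true) fW (finitary_letter _ _)) step.
  rewrite mulrDr; congr (_ + _); rewrite -step; congr (fine (P _)).
  by apply: eq_set => w; congr (is_true (_ && _)); case: (letters w c).
rewrite (expand a s) //; congr (_ * _).
have := expand c [::]; rewrite addn0 big_nil mul1r => -> //.
Qed.

End Law.

(** * Rare gaps and good windows *)

(** Take a partial sum that is [e]-close to the supremum. *)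
Lemma bounded_sum_tail (R : realType) (u : nat -> R) (C e : R) :
  (forall n, 0 <= u n) -> (forall N, \sum_(k <- iota 0 N) u k <= C) -> 0 < e ->
  exists N, forall j, \sum_(k <- iota N j) u k < e.
Proof.
move=> u0 uC e0; pose S := [set \sum_(k <- iota 0 N) u k | N in setT].
have supS : has_sup S.
  split; first by exists (\sum_(k <- iota 0 0) u k), 0%N.
  by exists C => _ [N _ <-].
have [_ [N _ <-] supN] := sup_adherent e0 supS.
exists N => j; have := iotaD 0 N j; rewrite add0n => NE.
have : \sum_(k <- iota 0 (N + j)) u k <= sup S.
  by apply: ub_le_sup; [exact: supS.2|exists (N + j)%N].
by rewrite NE big_cat /=; lra.
Qed.

(** The arithmetic of the inductive step of [Pr_no_rare_gap]: [a] is the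
probability of a gap at the first vertex, and [Q], [B], [L] those of having no
gap later, no gap at all, and no gap beyond the window; [D] is the probability
that the only gap is the first one. *)
Lemma product_bound_step (R : realDomainType) (S a L B D Q : R) :
  Q = D + B -> a * L <= D -> Q <= L -> Q <= 1 -> 0 <= B -> 0 <= a -> 0 <= S ->
  a <= 1 -> Q * (1 + S) <= 1 -> B * (1 + (a + S)) <= 1.
Proof.
move=> QE aLD QL Q1 B0 a0 S0 a1 QS.
have aQ : a * Q <= D by apply: le_trans aLD; exact: ler_wpM2l.
have h1 : B * (1 + S) <= (Q - a * Q) * (1 + S) by apply: ler_wpM2r; lra.
have h2 : (1 - a) * (Q * (1 + S)) <= (1 - a) * 1 by apply: ler_wpM2l; lra.
have h3 : a * B <= a * 1 by apply: ler_wpM2l => //; nra.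
by lra.
Qed.

(** The parity is counted from the right end, so that an alternating block on
the vertices 1, ..., [N] continues with [c] at [N.+1]. *)
Definition alternating (c : bool) (N : nat) : seq bool :=
  mkseq (fun i => c (+) odd (N - i)) N.

Definition has_both (M : nat -> nat) (n : nat) (x : nat -> bool) : bool :=
  (true \in window x n.+1 (M n)) && (false \in window x n.+1 (M n)).

Definition rare_gap (M : nat -> nat) (c : bool) (n : nat) : (nat -> bool) -> bool :=
  reads n (c :: nseq (M n) (~~ c)).

Definition no_rare_gap M c n j x := all (fun k => ~~ rare_gap M c k x) (iota n j).

(** Prescribing [c] at [N.+1] lets an alternating block on 1, ..., [N] that
ends in the other letter put both letters into the window of the vertex just
before [N], although that block is independent of this event. *)
Definition good_tail M c N j (x : nat -> bool) : bool :=
  (x N.+1 == c) && all (has_both M ^~ x) (iota N j).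

Section Deterministic.
Variables (M : nat -> nat) (c : bool).

Lemma notin_window (x : nat -> bool) e a k :
  e \notin window x a k -> reads a (nseq k (~~ e)) x.
Proof.
rewrite /reads size_nseq => nex.
have -> : nseq k (~~ e) = nseq (size (window x a k)) (~~ e).
  by rewrite size_map size_iota.
apply/eqP/all_pred1P/allP => b bx /=.
by apply: contraNT nex => be; case: (e) b be bx => [] [].
Qed.

Lemma alternating_both N x :
  {homo M : m n / (m <= n)%N} -> (2 <= M 0)%N ->
  reads 1 (alternating c N) x -> x N.+1 = c -> (forall n, (N <= n)%N -> has_both M n x) ->
  forall n e, e \in window x n.+1 (M n).
Proof.
move=> Mmono M0 /eqP; rewrite size_mkseq => xalt xN good n e.
have [/good/andP[]|nN] := leqP N n; first by case: e.
have xE j : (j <= N)%N -> x j.+1 = c (+) odd (N - j).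
  rewrite leq_eqVlt => /orP[/eqP->|jN]; first by rewrite subnn addbF.
  have := congr1 (fun s => nth true s j) xalt.
  by rewrite nth_mkseq // (nth_map 0%N) ?size_iota // nth_iota.
have Mn : (2 <= M n)%N by apply: leq_trans M0 _; exact: Mmono.
have alt : x n.+2 = ~~ x n.+1.
  rewrite !xE; [|lia..]; have -> : (N - n = (N - n.+1).+1)%N by lia.
  by rewrite /= addbN negbK.
apply/in_window; have [xe|xe] := eqVneq (x n.+1) e; first by exists n.+1; [lia|].
by exists n.+2; [lia|rewrite alt; case: (x _) e xe => [] []].
Qed.

Lemma determined_rare_gap n : determined n (n + (M n).+1) (rare_gap M c n).
Proof. by have := determined_reads n (c :: nseq (M n) (~~ c)); rewrite /= size_nseq. Qed.

Lemma determined_no_rare_gap n j : {homo M : m n / (m <= n)%N} ->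
  determined n (n + j + M (n + j)) (no_rare_gap M c n j).
Proof.
move=> Mmono; apply: (@determined_all _ _ _ _ (fun k x => ~~ rare_gap M c k x)) => k.
rewrite mem_iota => /andP[nk kn]; apply: determined_negb.
by apply: determined_sub (determined_rare_gap k); have := Mmono _ _ (ltnW kn); lia.
Qed.

Lemma rare_gapP n x : rare_gap M c n x ->
  x n = c /\ forall k, (n < k <= n + M n)%N -> x k = ~~ c.
Proof.
rewrite /rare_gap /reads /= size_nseq eqseq_cons => /andP[/eqP xn /eqP xw].
split=> // k hk; have := congr1 (fun s => nth true s (k - n.+1)) xw.
rewrite nth_nseq (nth_map 0%N) ?size_iota ?nth_iota; try lia.
by rewrite ifT ?subnKC //; lia.
Qed.

(** Inside a gap all letters differ from [c], whereas a gap begins with [c]. *)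
Lemma no_rare_gap_split n j x :
  rare_gap M c n x -> no_rare_gap M c (n + (M n).+1) (j - M n) x ->
  no_rare_gap M c n.+1 j x.
Proof.
move=> /rare_gapP[xn xw] /allP later; apply/allP => k; rewrite mem_iota => hk.
have [kn|kn] := leqP k (n + M n); last by apply: later; rewrite mem_iota; lia.
apply/negP => /rare_gapP[xk _].
by move: xk; rewrite xw; [case: (c)|lia].
Qed.

Lemma no_rare_gap_later n j x :
  no_rare_gap M c n.+1 j x -> no_rare_gap M c (n + (M n).+1) (j - M n) x.
Proof. by move=> /allP h; apply/allP => k; rewrite mem_iota => hk; apply: h; rewrite mem_iota; lia. Qed.

Lemma determined_has_both n : determined n.+1 (n.+1 + M n) (has_both M n).
Proof. exact: (determined_window _ _ (fun s => (true \in s) && (false \in s))). Qed.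

Lemma determined_good_tail N j : {homo M : m n / (m <= n)%N} ->
  determined N.+1 (N.+1 + j + M (N + j)).+1 (good_tail M c N j).
Proof.
move=> Mmono; apply: determined_andb.
  by apply: determined_sub (determined_letter N.+1 c); lia.
apply: determined_all => k; rewrite mem_iota => /andP[Nk kn].
by apply: determined_sub (determined_has_both k); have := Mmono _ _ (ltnW kn); lia.
Qed.

End Deterministic.

(** * Summability of the gap probabilities and its consequence *)

Section Estimates.
Context {R : realType} (p : R) (hp : 0 < p < 1).
Context {d : measure_display} {T : measurableType d} (P : probability T R).
Context (X : nat -> {RV P >-> bool}) (X_iid : iid_bernoulli p X).
Context (M : nat -> nat) (Mmono : {homo M : m n / (m <= n)%N}).
Context (c : bool).

Local Notation Pr := (Pr P X).
Local Notation letters := (letters P X).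
Let r := letter_prob p c.
Let t := letter_prob p (~~ c).

Lemma letter_prob_gt0 e : 0 < letter_prob p e.
Proof. by case/andP: hp => p0 p1; case: e; rewrite /letter_prob ?subr_gt0. Qed.

Lemma letter_prob_le1 e : letter_prob p e <= 1.
Proof.
case/andP: hp => p0 p1; case: e; rewrite /letter_prob; first exact: ltW.
by rewrite gerBl ltW.
Qed.

Lemma prod_letter_nseq e k :
  \prod_(b <- nseq k e) letter_prob p b = letter_prob p e ^+ k.
Proof. by elim: k => [|k IH] /=; rewrite ?big_nil ?expr0 // big_cons IH exprS. Qed.

(** Removing the first vertex: [no_rare_gap] from [n.+1] on splits according to
whether there is a gap at [n], and a gap at [n] is independent of the gaps
beyond its window, which are the only other gaps compatible with it. *)
Lemma Pr_no_rare_gap n j :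
  Pr (no_rare_gap M c n j) * (1 + \sum_(k <- iota n j) r * t ^+ M k) <= 1.
Proof.
elim: j n => [|j IH] n /=.
  by rewrite big_nil addr0 mulr1; apply: Pr_le1; exists 0%N.
rewrite big_cons.
have fB m i : finitary (no_rare_gap M c m i).
  exact: (determined_finitary _ _ _ (determined_no_rare_gap M c m i Mmono)).
have fA : finitary (rare_gap M c n).
  exact: (determined_finitary _ _ _ (determined_rare_gap M c n)).
have split := Pr_split P X _ _ (fB n.+1 j) fA.
have -> : Pr (no_rare_gap M c n j.+1) =
    Pr (fun x => no_rare_gap M c n.+1 j x && ~~ rare_gap M c n x).
  by congr (fine (P _)); apply: eq_set => w; rewrite andbC.
set later := no_rare_gap M c (n + (M n).+1) (j - M n).
have gap : r * t ^+ M n * Pr later <=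
    Pr (fun x => no_rare_gap M c n.+1 j x && rare_gap M c n x).
  have dl := determined_no_rare_gap M c (n + (M n).+1) (j - M n) Mmono.
  have := Pr_cylinder_indep p hp P X X_iid n (c :: nseq (M n) (~~ c)) _ later.
  rewrite /= size_nseq => /(_ _ dl); rewrite big_cons prod_letter_nseq => <-.
  apply: Pr_le; 
    [exact: (finitary_andb _ _ fA (fB _ _))|exact: (finitary_andb _ _ (fB _ _) fA)|].
  move=> x /andP[gx lx].
  by rewrite [X in _ && X]gx andbT; exact: no_rare_gap_split gx lx.
have mono : Pr (no_rare_gap M c n.+1 j) <= Pr later.
  by apply: Pr_le (fB _ _) (fB _ _) _ => x; exact: no_rare_gap_later.
have le1 := Pr_le1 P X _ (fB n.+1 j).
have {IH} := IH n.+1.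
have a0 : 0 <= r * t ^+ M n.
  by rewrite mulr_ge0 ?exprn_ge0 // ltW // letter_prob_gt0.
have S0 : 0 <= \sum_(k <- iota n.+1 j) r * t ^+ M k.
  by apply: sumr_ge0 => k _; rewrite mulr_ge0 ?exprn_ge0 // ltW // letter_prob_gt0.
have B0 := Pr_ge0 P X (fun x => no_rare_gap M c n.+1 j x && ~~ rare_gap M c n x).
have a1 : r * t ^+ M n <= 1.
  by rewrite mulr_ile1 ?exprn_ile1 ?exprn_ge0 ?letter_prob_le1 // ltW // letter_prob_gt0.
move=> IHn; exact: (product_bound_step _ _ _ _ _ _ _ split gap mono le1 B0 a0 S0 a1 IHn).
Qed.

Lemma Pr_letter n e : Pr (fun x => x n == e) = letter_prob p e.
Proof.
have := Pr_cylinder p hp P X X_iid n [:: e]; rewrite big_seq1 => <-.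
by congr (fine (P _)); apply: eq_set => w; rewrite /reads /= eqseq_cons eqxx andbT.
Qed.

Lemma Pr_notin_window e a k :
  Pr (fun x => e \notin window x a k) <= letter_prob p (~~ e) ^+ k.
Proof.
rewrite -prod_letter_nseq -(Pr_cylinder p hp P X X_iid a).
apply: Pr_le => [||x]; last exact: notin_window.
  exact: (determined_finitary _ _ _ (determined_window a k (fun s => e \notin s))).
exact: (determined_finitary _ _ _ (determined_reads a (nseq k (~~ e)))).
Qed.

Lemma Pr_not_both n : r <= t -> Pr (negb \o has_both M n) <= (t ^+ M n) *+ 2.
Proof.
move=> c_rare; have fW e := determined_finitary _ _ _
  (determined_window n.+1 (M n) (fun s => e \in s)).
have fH := determined_finitary _ _ _ (determined_has_both M n).
have letter_le e : letter_prob p e ^+ M n <= t ^+ M n.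
  apply: lerXn2r; rewrite ?nnegrE; try exact/ltW/letter_prob_gt0.
  by move: c_rare; rewrite /r /t; case: (c) (e) => [] [].
rewrite (Pr_split P X _ _ (finitary_negb _ fH) (fW true)) mulr2n lerD //.
  apply: le_trans (letter_le (~~ false)); apply: le_trans (Pr_notin_window false n.+1 _).
  apply: Pr_le => [||x].
  - exact: (finitary_andb _ _ (finitary_negb _ fH) (fW true)).
  - exact: (finitary_negb _ (fW false)).
  - by rewrite /= /has_both; case: (true \in _); rewrite ?andbF ?andbT.
apply: le_trans (letter_le (~~ true)); apply: le_trans (Pr_notin_window true n.+1 _).
apply: Pr_le => [||x].
- exact: (finitary_andb _ _ (finitary_negb _ fH) (finitary_negb _ (fW true))).
- exact: (finitary_negb _ (fW true)).
- by move=> /andP[].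
Qed.

(** Union bound over the windows, one missing letter at a time. *)
Lemma Pr_good_tail N j : r <= t ->
  r - \sum_(k <- iota N j) (t ^+ M k) *+ 2 <= Pr (good_tail M c N j).
Proof.
move=> c_rare; elim: j => [|j IH].
  rewrite big_nil subr0 /r -(Pr_letter N.+1) le_eqVlt; apply/orP; left; apply/eqP.
  by congr (fine (P _)); apply: eq_set => w; rewrite /good_tail /= andbT.
have fG := determined_finitary _ _ _ (determined_good_tail M c N j Mmono).
have fH := determined_finitary _ _ _ (determined_has_both M (N + j)).
rewrite -addn1 iotaD big_cat big_seq1 opprD addrA.
have -> : Pr (good_tail M c N (j + 1)) =
    Pr (fun x => good_tail M c N j x && has_both M (N + j) x).
  congr (fine (P _)); apply: eq_set => w.
  by rewrite /good_tail iotaD all_cat /= andbT andbA.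
rewrite lerBlDr; apply: le_trans IH _; rewrite (Pr_split P X _ _ fG fH) lerD2l.
apply: le_trans (Pr_not_both _ c_rare); apply: Pr_le => [||x /andP[]//].
  exact: (finitary_andb _ _ fG (finitary_negb _ fH)).
exact: finitary_negb.
Qed.

(** There are uncountably many words but countably many finite prefixes. *)
Lemma measurable_all_words_seen : measurable [set w | W (edges M) (letters w) 0 = setT].
Proof.
have -> : [set w | W (edges M) (letters w) 0 = setT] =
    \bigcap_n [set w | if @choice.unpickle (seq bool) n is Some s
                       then sees M (letters w) 0 s else true].
  apply/seteqP; split=> w; rewrite {1}/mkset => hw.
    move=> n _; case: (@choice.unpickle (seq bool) n) => //= s.
    have : W (edges M) (letters w) 0 (nth true s) by rewrite hw.
    by move=> /seen_prefixes /(_ (size s)); rewrite /window -/(mkseq _ _) mkseq_nth.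
  rewrite /mkset; apply/seteqP; split=> // xi _; apply/seen_prefixes => n.
  by have := hw (choice.pickle (window xi 0 n)) I; rewrite choice.pickleK.
apply: bigcapT_measurable => n.
apply: (finitary_measurable P X
  (fun x => if @choice.unpickle (seq bool) n is Some s then sees M x 0 s else true)).
by case: (@choice.unpickle (seq bool) n) => [s|]; [exact: finitary_sees|exists 0%N].
Qed.

Lemma measurable_seen xi : measurable [set w | W (edges M) (letters w) 0 xi].
Proof.
have -> : [set w | W (edges M) (letters w) 0 xi] =
    \bigcap_n [set w | sees M (letters w) 0 (window xi 0 n)].
  apply/seteqP; split=> w /=; first by move=> /seen_prefixes h n _; exact: h.
  by move=> h; apply/seen_prefixes => n; exact: h.
apply: bigcapT_measurable => n.
exact: (finitary_measurable P X _ (finitary_sees M 0 _)).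
Qed.

Lemma seen_rare_summable :
  (0 < P [set w | W (edges M) (letters w) 0 (fun=> c)])%E ->
  exists C, forall N, \sum_(k <- iota 0 N) t ^+ M k <= C.
Proof.
set E := [set _ | _] => PE.
have mE : measurable E := measurable_seen _.
have EK : (fine (P E))%:E = P E by rewrite fineK // fin_num_measure.
have {}PE : 0 < fine (P E) by rewrite -lte_fin EK.
have r0 : 0 < r := letter_prob_gt0 c.
exists ((fine (P E))^-1 / r) => N.
have EB : fine (P E) <= Pr (no_rare_gap M c 0 N).
  have fB := determined_finitary _ _ _ (determined_no_rare_gap M c 0 N Mmono).
  rewrite -lee_fin EK -Pr_fineK //; apply: le_measure; rewrite ?inE //.
    exact: finitary_measurable.
  move=> w /(seen_constant_window M _ _ _ Mmono) seenw; apply/allP => k _.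
  apply/negP => /rare_gapP[_ gap].
  have /in_window[u uk] := seenw k.
  by rewrite gap; [case: (c)|lia].
have := Pr_no_rare_gap 0 N; rewrite -mulr_sumr => h.
have S0 : 0 <= \sum_(k <- iota 0 N) t ^+ M k.
  by apply: sumr_ge0 => k _; rewrite exprn_ge0 // ltW // letter_prob_gt0.
rewrite ler_pdivlMr // -[leRHS]mul1r ler_pdivlMr //.
have : fine (P E) * (1 + r * \sum_(k <- iota 0 N) t ^+ M k) <= 1.
  by apply: le_trans h; apply: ler_wpM2r => //; rewrite addr_ge0 // mulr_ge0 // ltW.
by lra.
Qed.

(** The events [F j] below decrease to an event on which all windows are good,
and independence bounds their probabilities below uniformly in [j]. *)
Lemma all_words_seen_positive C : (2 <= M 0)%N -> r <= t ->
  (forall N, \sum_(k <- iota 0 N) t ^+ M k <= C) ->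
  (0 < P [set w | W (edges M) (letters w) 0 = setT])%E.
Proof.
move=> M0 c_rare SC; have r0 : 0 < r := letter_prob_gt0 c.
(* The tail counts twice, once per missing letter, so r / 2 is left over. *)
have [||N tail] := @bounded_sum_tail R (fun k => t ^+ M k) C (r / 4) _ SC.
- by move=> n; rewrite exprn_ge0 // ltW // letter_prob_gt0.
- by rewrite divr_gt0.
pose s := alternating c N; pose h := \prod_(e <- s) letter_prob p e.
have h0 : 0 < h by apply: prodr_gt0 => e _; exact: letter_prob_gt0.
pose F j x := reads 1 s x && good_tail M c N j x.
pose E j := [set w | F j (letters w)].
have fF j : finitary (F j).
  apply: finitary_andb; first exact: (determined_finitary _ _ _ (determined_reads 1 s)).
  exact: (determined_finitary _ _ _ (determined_good_tail M c N j Mmono)).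
have mE j : measurable (E j) by exact: finitary_measurable.
have PE j : ((h * (r / 2))%:E <= P (E j))%E.
  rewrite /E Pr_fineK // lee_fin (Pr_cylinder_indep p hp P X X_iid 1 s
    (N.+1 + j + M (N + j)).+1); last first.
    by rewrite size_mkseq; exact: determined_good_tail.
  rewrite ler_pM2l //; apply: le_trans (Pr_good_tail N j c_rare).
  by rewrite sumrMnl; have := tail j; lra.
have mcap : measurable (\bigcap_j E j) := bigcapT_measurable mE.
have Ecap : \bigcap_j E j `<=` [set w | W (edges M) (letters w) 0 = setT].
  move=> w Ew /=; apply: all_words_seen.
  have /andP[alt /andP[/eqP xN _]] := Ew 0%N I.
  apply: (alternating_both M c N _ Mmono M0 alt xN) => n Nn.
  have /andP[_ /andP[_ /allP]] := Ew (n - N).+1 I.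
  by apply; rewrite mem_iota; lia.
apply: lt_le_trans (le_measure _ _ _ Ecap); rewrite ?inE //; last first.
  exact: measurable_all_words_seen.
apply: (@lt_le_trans _ _ (h * (r / 2))%:E).
  by rewrite lte_fin mulr_gt0 // divr_gt0.
have cvgE : (P \o E) n @[n --> \oo] --> P (\bigcap_j E j).
  apply: nonincreasing_cvg_mu => //.
    by rewrite ltey_eq fin_num_measure.
  move=> i j ij; apply/subsetPset => w /andP[alt /andP[xN /allP all]].
  apply/andP; split=> //; apply/andP; split=> //; apply/allP => k ki.
  by apply: all; move: ki; rewrite !mem_iota; lia.
apply: cvge_ge cvgE; exact: nearW.
Qed.

End Estimates.

(** * The equivalence *)

Theorem theorem1p5 (R : realType) (p : R) (hp : 0 < p < 1)
    (M : nat -> nat) (M_nondecr : {homo M : m n / (m <= n)%N})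
    (M0_ge2 : (2 <= M 0)%N)
    (d : measure_display) (T : measurableType d) (P : probability T R)
    (X : nat -> {RV P >-> bool}) (X_iid : iid_bernoulli p X) :
  (0 < P [set w | W (edges M) (fun n => X n w) 0 (xi_star p)])%E <->
  (0 < P [set w | W (edges M) (fun n => X n w) 0 = setT])%E.
Proof.
split.
  have [c -> c_rare] : exists2 c, xi_star p = (fun=> c) &
      letter_prob p c <= letter_prob p (~~ c).
    rewrite /xi_star; case: (leP 2^-1 p) => h; [exists false|exists true] => //=; lra.
  move=> /(seen_rare_summable p hp P X X_iid M M_nondecr c)[C SC].
  exact: (all_words_seen_positive p hp P X X_iid M M_nondecr c C M0_ge2 c_rare SC).
move=> /lt_le_trans; apply; apply: le_measure; rewrite ?inE.
- exact: (measurable_all_words_seen P X M).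
- exact: (measurable_seen P X M).
- by move=> w /= ->.
Qed.
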